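(* Let $\kappa>0$. In the stochastic arrival model there exists a delayed algorithm that is at least $\max\left\{\frac{1-e^{-\kappa}}{\kappa},1-e^{-\kappa}\right\}$-competitive on the family of $\kappa$-undersupplied instances, and likewise on the family of $\kappa$-oversupplied instances; i.e. $\inf_{\mathcal I\in\mathcal F}\mathbb E[\mathrm{ALG}(\mathcal I)]/\mathrm{OFF\text{-}I}(\mathcal I)\ge\max\left\{\frac{1-e^{-\kappa}}{\kappa},1-e^{-\kappa}\right\}$ for the relevant family $\mathcal F$.
   Context: Stochastic online matching with stochastic rewards. An instance $\mathcal I$ consists of a finite set $S$ of supply nodes, a finite set $V$ of demand types, consumption probabilities $\mu_{u,v}\in[0,1]$ for $u\in S,v\in V$, a probability distribution $\{p_v\}_{v\in V}$, and a horizon $T$. In each period $t=1,\dots,T$ an arrival of type $v_t$ drawn i.i.d. from $p$ appears; the algorithm observes its type and irrevocably matches it to some $u\in N(v_t)=\{u:\mu_{u,v_t}>0\}$ or leaves it unmatched. If an arrival of type $v$ is matched to $u$, independently with probability $\mu_{u,v}$ it chooses to consume $u$, and $u$ is consumed if not consumed before. The value is the number of consumed supply nodes; $\mathbb E[\mathrm{ALG}(\mathcal I)]$ is its expectation over arrivals, algorithm randomness and consumption outcomes. A delayed algorithm's decision in period $t$ may depend on its random seed, the arrivals so far and its own previous matching decisions, but not on realized consumption outcomes. For $\kappa>0$, $\mathrm{OFF\text{-}I}(\mathcal I,\kappa)$ is the optimal value of the LP: maximize $\sum_{u\in S,v\in V}\mu_{u,v}x_{u,v}$ s.t. $\sum_{v\in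 V}\mu_{u,v}x_{u,v}\le\kappa$ for all $u\in S$, $\sum_{u\in S}x_{u,v}\le Tp_v$ for all $v\in V$, $x\ge0$; $\mathrm{OFF\text{-}I}(\mathcal I)=\mathrm{OFF\text{-}I}(\mathcal I,1)$. An instance is $\kappa$-undersupplied if $\kappa=\max\{\bar\kappa\ge1:\mathrm{OFF\text{-}I}(\mathcal I,\bar\kappa)=\bar\kappa\,\mathrm{OFF\text{-}I}(\mathcal I)\}$ and $\kappa$-oversupplied if $\kappa=\min\{\bar\kappa\le1:\mathrm{OFF\text{-}I}(\mathcal I,\bar\kappa)=\mathrm{OFF\text{-}I}(\mathcal I)\}$; these extrema are assumed attained at rational numbers. *)

(* Defs.v *)
From HB Require Import structures.
From mathcomp Require Export all_boot all_order all_algebra.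
From mathcomp Require Export all_classical all_reals all_analysis.

Set Implicit Arguments.
Unset Strict Implicit.
Unset Printing Implicit Defensive.

Import Order.TTheory GRing.Theory Num.Theory.

Local Open Scope classical_set_scope.
Local Open Scope ring_scope.

Record instance (R : realType) := Instance {
  supply : finType;
  demand : finType;
  mu : supply -> demand -> R;
  arrival : demand -> R;
  horizon : nat;
  mu_itv : forall u v, 0 <= mu u v <= 1;
  arrival_ge0 : forall v, 0 <= arrival v;
  arrival_sum : \sum_(v : demand) arrival v = 1
}.

Section LP.
Variables (R : realType) (I : instance R).

Definition feasible (kappa : R) (x : supply I -> demand I -> R) : Prop :=
  [/\ forall u, \sum_(v : demand I) mu u v * x u v <= kappa,
      forall v, \sum_(u : supply I) x u v <= (horizon I)%:R * arrival v
    & forall u v, 0 <= x u v].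

Definition objective (x : supply I -> demand I -> R) : R :=
  \sum_(u : supply I) \sum_(v : demand I) mu u v * x u v.

Definition OFF_I (kappa : R) : R := sup [set objective x | x in feasible kappa].

(* The last conjunct of the two definitions below is the standing assumption
   that the extrema are attained at rational numbers. *)
Definition undersupplied (kappa : R) : Prop :=
  let K := [set k : R | 1 <= k /\ OFF_I k = k * OFF_I 1] in
  [/\ K kappa, ubound K kappa & range (@ratr R) kappa].

(* [0 < k] because [OFF_I k] is only considered for positive [k]. *)
Definition oversupplied (kappa : R) : Prop :=
  let K := [set k : R | 0 < k <= 1 /\ OFF_I k = OFF_I 1] in
  [/\ K kappa, lbound K kappa & range (@ratr R) kappa].

End LP.

(* [decide w [:: v_1; ..; v_t] [:: m_1; ..; m_(t-1)]] is the decision taken in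
   period t when the seed is w, the arrivals so far are v_1, .., v_t and the
   previous decisions were m_1, .., m_(t-1); [None] leaves v_t unmatched.
   Consumption outcomes are not an argument, so the algorithm is delayed. *)
Record delayed_alg (R : realType) (I : instance R) := DelayedAlg {
  seed_disp : measure_display;
  seed : measurableType seed_disp;
  seed_law : probability seed R;
  decide : seed -> seq (demand I) -> seq (option (supply I)) ->
           option (supply I);
  decide_measurable : forall vs ms m,
    measurable [set w : seed | decide w vs ms = m];
  decide_neighbor : forall w vs v ms u,
    decide w (rcons vs v) ms = Some u -> 0 < mu u v
}.

Section Value.
Variables (R : realType) (I : instance R) (A : delayed_alg I).

Fixpoint decisions (w : seed A) (vs : seq (demand I)) (t : nat) :
    seq (option (supply I)) :=
  if t is s.+1 then
    rcons (decisions w vs s) (decide w (take s.+1 vs) (decisions w vs s))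
  else [::].

Definition decision (w : seed A) (vs : (horizon I).-tuple (demand I))
    (t : 'I_(horizon I)) : option (supply I) :=
  nth None (decisions w vs (horizon I)) t.

Definition outcome_prob (m : option (supply I)) (v : demand I) (c : bool) : R :=
  let q := if m is Some u then mu u v else 0 in
  if c then q else 1 - q.

Definition num_consumed (w : seed A) (vs : (horizon I).-tuple (demand I))
    (c : (horizon I).-tuple bool) : nat :=
  #|[pred u : supply I |
      [exists t, (decision w vs t == Some u) && tnth c t]]|.

(* Expected value for the fixed seed w, over the arrivals vs and the outcomes
   c, where [tnth c t] tells whether the arrival of period t chooses to consume
   the supply node it is matched to. *)
Definition seed_value (w : seed A) : R :=
  \sum_(vs : (horizon I).-tuple (demand I))
    (\prod_(t < horizon I) arrival (tnth vs t)) *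
    \sum_(c : (horizon I).-tuple bool)
      (\prod_(t < horizon I)
         outcome_prob (decision w vs t) (tnth vs t) (tnth c t)) *
      (num_consumed w vs c)%:R.

Definition expected_ALG : \bar R := 'E_(seed_law A)[seed_value]%E.

End Value.

(* A family is a Prop-valued predicate rather than a [set], whose universe is
   too small for [instance R]. *)
Definition competitive_ratio (R : realType)
    (ALG : forall I : instance R, delayed_alg I) (F : instance R -> Prop) :
    \bar R :=
  ereal_inf [set r | exists I : instance R,
    F I /\ r = (expected_ALG (ALG I) * ((OFF_I I 1)^-1)%:E)%E].

(* Main.v *)
Require Import Defs.
From mathcomp Require Import ring lra.

(** Let [x] be an optimal solution of the LP with capacity [kappa] (attained by
    compactness).  Matching an arrival of type [v] to [u] with probability
    [x u v / (T p_v)], independently over periods, consumes [u] with probability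
    [1 - (1 - y_u / T) ^ T >= 1 - e^(- y_u)], where [y_u = \sum_v mu u v * x u v]
    is at most [kappa]; by convexity of the exponential this is at least
    [y_u (1 - e^(- kappa)) / kappa].  Summing over [u], the expected value is at
    least [OFF_I kappa * (1 - e^(- kappa)) / kappa], and [OFF_I kappa] equals
    [kappa * OFF_I 1] on undersupplied and [OFF_I 1] on oversupplied instances.
    Such a strategy is a mixture of finitely many deterministic ones, so one of
    them does at least as well as the average; this one is the algorithm. *)

Set Implicit Arguments.
Unset Strict Implicit.
Unset Printing Implicit Defensive.

Import Order.TTheory GRing.Theory Num.Theory.
Import numFieldNormedType.Exports.

Local Open Scope classical_set_scope.
Local Open Scope ring_scope.

(** * Finite product weights, averages and an exponential bound *)

Lemma sum_tuple_prod (R : comPzRingType) (n : nat) (A : finType)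
    (F : 'I_n -> A -> R) :
  \sum_(c : n.-tuple A) \prod_(t < n) F t (tnth c t) =
  \prod_(t < n) \sum_(a : A) F t a.
Proof.
rewrite bigA_distr_bigA /=.
rewrite (reindex (fun f : {ffun 'I_n -> A} => [tuple f i | i < n])) /=.
  by apply: eq_bigr => f _; apply: eq_bigr => t _; rewrite tnth_mktuple.
exists (fun c : n.-tuple A => [ffun i => tnth c i]) => x _.
  by apply/ffunP => i; rewrite ffunE tnth_mktuple.
by apply: eq_from_tnth => i; rewrite tnth_mktuple ffunE.
Qed.

(** The indicator of a union is one minus the product of the complementary indicators; in this form
    the expected count factors over independent periods. *)
Lemma card_exists_sum (R : comPzRingType) (U : finType) (n : nat)
    (P : U -> 'I_n -> bool) :
  #|[pred u | [exists t, P u t]]|%:R =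
  \sum_(u : U) (1 - \prod_(t < n) (1 - (P u t)%:R)) :> R.
Proof.
rewrite -sum1_card natr_sum big_mkcond /=; apply: eq_bigr => u _.
rewrite inE; case: existsP => [[t Put]|Pu].
  by rewrite (bigD1 t) //= Put subrr mul0r subr0.
by rewrite big1 ?subrr // => t _; case: (boolP (P u t)) => [Put|_];
   [case: Pu; exists t | rewrite subr0].
Qed.

(** A marginal of the product law: absorbing the indicator into the factor at [a] lets the sum
    distribute, and every other factor sums to 1. *)
Lemma sum_ffun_prod_eq (R : comPzRingType) (A B : finType)
    (q : A -> B -> R) (a : A) (b : B) :
  (forall a, \sum_(b : B) q a b = 1) ->
  \sum_(f : {ffun A -> B}) (\prod_(a : A) q a (f a)) * (f a == b)%:R = q a b.
Proof.
move=> q1.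
pose F (a' : A) b' := q a' b' * (if a' == a then (b' == b)%:R else 1).
transitivity (\sum_(f : {ffun A -> B}) \prod_a' F a' (f a')).
  apply: eq_bigr => f _; rewrite /F big_split /=; congr (_ * _).
  by rewrite -big_mkcond /= big_pred1_eq.
rewrite -bigA_distr_bigA /= (bigD1 a) //= [X in _ * X]big1 ?mulr1.
  rewrite (bigD1 b) //= big1 ?addr0 /F ?eqxx ?mulr1 // => b' /negPf ->.
  by rewrite mulr0.
move=> a' /negPf na; rewrite -[RHS](q1 a'); apply: eq_bigr => b' _.
by rewrite /F na mulr1.
Qed.

Lemma sum_ffun_prod1 (R : comPzRingType) (A B : finType) (q : A -> B -> R) :
  (forall a, \sum_(b : B) q a b = 1) ->
  \sum_(f : {ffun A -> B}) \prod_(a : A) q a (f a) = 1.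
Proof. by move=> q1; rewrite -bigA_distr_bigA /= big1. Qed.

(** Were [m] above every [F a], the nonnegative terms [w a * (m - F a)] would sum to 0, forcing
    every weight to vanish. *)
Lemma exists_ge_average (R : realDomainType) (A : finType) (w F : A -> R) (m : R) :
  (forall a, 0 <= w a) -> \sum_a w a = 1 -> m <= \sum_a w a * F a ->
  exists a, m <= F a.
Proof.
move=> w0 w1 mF; apply/not_existsP => Fm; have {}Fm a : F a < m.
  by rewrite ltNge; apply/negP => /(Fm a).
have : \sum_a w a * F a <= \sum_a w a * m.
  by apply: ler_sum => a _; rewrite ler_wpM2l // ltW.
rewrite -mulr_suml w1 mul1r => le_m.
have E : \sum_a w a * (m - F a) = 0.
  under eq_bigr do rewrite mulrBr.
  rewrite big_split /= -mulr_suml w1 mul1r sumrN.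
  by apply/eqP; rewrite subr_eq0 eq_le mF le_m.
have [a wa] : exists a, w a != 0.
  apply/not_existsP => H; move: w1; rewrite big1 => [|a _].
    by move/eqP; rewrite eq_sym oner_eq0.
  by apply/eqP/negPn/negP.
move: E => /eqP; rewrite psumr_eq0 => [/allP/(_ a)|b _].
  by rewrite mem_index_enum mulf_eq0 (negPf wa) subr_eq0 gt_eqF //= => /(_ isT).
by rewrite mulr_ge0 // subr_ge0 ltW.
Qed.

Lemma one_minus_pow_ge (R : realType) (k s : R) (n : nat) :
  0 < k -> 0 <= s <= 1 -> n%:R * s <= k ->
  (n%:R * s) * ((1 - expR (- k)) / k) <= 1 - (1 - s) ^+ n.
Proof.
move=> k0 /andP[s0 s1] nsk; set y := n%:R * s.
have y0 : 0 <= y by rewrite mulr_ge0.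
have pe : (1 - s) ^+ n <= expR (- y).
  rewrite /y -mulrN mulrC expRM_natr lerXn2r ?nnegrE ?expR_ge0 ?subr_ge0 //.
  exact: expR_ge1Dx.
have t01 : 0 <= y / k <= 1 
  by rewrite (divr_ge0 y0 (ltW k0)) ler_pdivrMr // mul1r.
have [t tE] : exists t : {i01 R}, t%:num = y / k.
  by case/andP: t01 => a b; exists (Itv01 a b).
(* The chord of [expR] between [- k] and [0], taken at [- y] with weight [y / k] on [- k]. *)
have := convex_expR t (- k) 0.
rewrite !convRE /= expR0 mulr0 addr0 tE /unstable.onem mulr1 mulrN divfK ?gt_eqF //.
move=> H; rewrite mulrA mulrAC mulrBr mulr1; lra.
Qed.

(** * The linear program: attainment and scaling *)

Section LinearProgram.
Variables (R : realType) (I : instance R).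
Implicit Types (k : R) (x : supply I -> demand I -> R).

Lemma feasible_bound k x u v :
  feasible k x -> x u v <= (horizon I)%:R * arrival v.
Proof.
move=> [_ xv x0]; apply: le_trans (xv v).
by rewrite (bigD1 u) //= lerDl sumr_ge0.
Qed.

Lemma objective_bound k x : feasible k x -> objective x <= #|supply I|%:R * k.
Proof.
move=> [xk _ _]; rewrite mulrC -sum1_card natr_sum mulr_sumr.
by apply: ler_sum => u _; rewrite mulr1.
Qed.

Lemma feasible0 k : 0 <= k -> feasible k (fun (_ : supply I) (_ : demand I) => 0).
Proof.
move=> k0; split=> [u|v|//].
  by rewrite big1 // => v _; rewrite mulr0.
by rewrite big1 // mulr_ge0 ?arrival_ge0.
Qed.

Lemma OFF_I_ge k x : feasible k x -> objective x <= OFF_I I k.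
Proof.
move=> fx; apply: ub_le_sup; last by exists x.
by exists (#|supply I|%:R * k) => _ [y fy <-]; exact: objective_bound fy.
Qed.

Lemma OFF_I_attained k : 0 <= k ->
  exists2 x : supply I -> demand I -> R,
    feasible k x & objective x = OFF_I I k.
Proof.
move=> k0.
(* Indexing the variables by pairs places the polytope in a single product space, where Tychonoff's
   theorem applies. *)
pose T : topologicalType := prod_topology (fun _ : supply I * demand I => R).
pose curry (f : T) u v : R := f (u, v).
pose A : set T := [set f | feasible k (curry f)].
have pc u v : continuous (fun f : T => curry f u v).
  exact: (@proj_continuous _ _ (u, v)).
have mc u v : continuous (fun f : T => mu u v * curry f u v).
  move=> f.
  exact: (continuous_comp (pc u v f) (@mulrl_continuous _ (mu u v) (curry f u v))).
have sumc (J : finType) (F : J -> T -> R) :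
    (forall j, continuous (F j)) -> continuous (fun f => \sum_j F j f).
  move=> Fc; apply: (@continuous_big R J +%R 0 predT (@add_continuous R)
    T (index_enum J) F) => j _; exact: Fc.
have cA : closed A.
  have -> : A =
      (\bigcap_u [set f : T | \sum_v mu u v * curry f u v <= k]) `&`
      (\bigcap_v [set f : T | \sum_u curry f u v <= (horizon I)%:R * arrival v])
      `&` (\bigcap_u \bigcap_v [set f : T | 0 <= curry f u v]).
    apply/seteqP; split=> [f [f1 f2 f3]|f [[f1 f2] f3]].
      by split; [split=> [u _|v _]; [exact: f1|exact: f2] | move=> u _ v _; exact: f3].
    by split=> [u|v|u v]; [exact: f1|exact: f2|exact: f3].
  apply: closedI; [apply: closedI|].
  - apply: closed_bigI => u _.
    apply: (preimage_closed _ (@closed_le R k)) => f _.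
    by apply: sumc => v; exact: mc.
  - apply: closed_bigI => v _.
    apply: (preimage_closed _ (@closed_le R _)) => f _.
    by apply: sumc => u; exact: pc.
  - apply: closed_bigI => u _; apply: closed_bigI => v _.
    apply: (preimage_closed _ (@closed_ge R 0)) => f _.
    exact: pc.
(* Nonnegativity and the demand constraints confine each coordinate to a segment, so the closed set
   [A] lies in a compact box. *)
have kA : compact A.
  have kB : compact [set f : T |
      forall i, `[0, (horizon I)%:R * arrival i.2]%classic (f i)].
    exact: (@tychonoff _ (fun=> R) (fun i => `[0, (horizon I)%:R * arrival i.2]%classic)
      (fun i => @segment_compact R _ _)).
  apply: (subclosed_compact cA kB) => f fA [u v].
  have [_ _ f0] := fA.
  by rewrite /= in_itv /= (feasible_bound u v fA) andbT; exact: f0.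
have A0 : A !=set0 by exists (fun _ => 0); exact: feasible0.
have [|f /set_mem fA fmax] := compact_EVT_max (f := fun f => objective (curry f)) A0 kA.
  apply: continuous_subspaceT; apply: (sumc) => u; apply: (sumc) => v; exact: mc.
exists (curry f) => //; apply/le_anti; rewrite OFF_I_ge //=.
apply: ge_sup => [|_ [y fy <-]]; first by exists (objective (curry f)), (curry f).
by apply: (fmax (fun i => y i.1 i.2)); apply/mem_set.
Qed.

Lemma OFF_I_ge0 k : 0 <= k -> 0 <= OFF_I I k.
Proof.
move=> k0; have := OFF_I_ge (feasible0 k0); rewrite /objective big1 //.
by move=> u _; rewrite big1 // => v _; rewrite mulr0.
Qed.

(** Dividing a solution by [Num.max k 1] brings its loads below 1; a divisor of at least 1 also
    preserves the demand constraints, which [k < 1] alone could break. *)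
Lemma OFF_I_scale k : 0 < k -> OFF_I I k <= Num.max k 1 * OFF_I I 1.
Proof.
move=> k0; have [x [x1 x2 x3] <-] := OFF_I_attained (ltW k0).
have m0 : 0 < Num.max k 1 by rewrite lt_max k0.
rewrite mulrC -ler_pdivrMr //.
have fy : feasible 1 (fun u v => (Num.max k 1)^-1 * x u v).
  split=> [u|v|u v].
  - under eq_bigr do rewrite mulrCA.
    rewrite -mulr_sumr mulrC ler_pdivrMr // mul1r.
    by apply: le_trans (x1 u) _; rewrite le_max lexx.
  - rewrite -mulr_sumr mulrC ler_pdivrMr //; apply: le_trans (x2 v) _.
    by rewrite ler_peMr ?le_max ?lexx ?orbT // mulr_ge0 ?arrival_ge0.
  - by rewrite mulr_ge0 // invr_ge0 ltW.
apply: le_trans (OFF_I_ge fy); rewrite mulrC /objective mulr_sumr.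
apply: ler_sum => u _; rewrite mulr_sumr; apply: ler_sum => v _.
by rewrite mulrCA.
Qed.

(** Rules out degenerate instances: with value 0 at capacity 1, the sets behind [undersupplied] and
    [oversupplied] have no extremum. *)
Lemma OFF_I_eq0 k : OFF_I I 1 = 0 -> 0 < k -> OFF_I I k = 0.
Proof.
move=> O1 k0; apply/le_anti; rewrite OFF_I_ge0 ?(ltW k0) // andbT.
by rewrite -(mulr0 (Num.max k 1)) -O1 OFF_I_scale.
Qed.

End LinearProgram.

(** * Nonadaptive policies and their exact value *)

Section Decisions.
Variables (R : realType) (I : instance R) (A : delayed_alg I).

Lemma size_decisions (w : seed A) vs n : size (decisions w vs n) = n.
Proof. by elim: n => //= n IHn; rewrite size_rcons IHn. Qed.

Lemma nth_decisions (w : seed A) vs n t : (t < n)%N ->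
  nth None (decisions w vs n) t = decide w (take t.+1 vs) (decisions w vs t).
Proof.
elim: n => // n IHn; rewrite ltnS leq_eqVlt => /predU1P[->|tn] /=.
  by rewrite nth_rcons size_decisions ltnn eqxx.
by rewrite nth_rcons size_decisions tn IHn.
Qed.

End Decisions.

Section Policy.
Variables (R : realType) (I : instance R).
Variable g : nat -> demand I -> option (supply I).

(** Makes an arbitrary [g] legal: a proposed node with zero consumption probability is dropped,
    which changes no chance of consumption. *)
Definition neighbor_only (v : demand I) (m : option (supply I)) :=
  if m is Some u then if 0 < mu u v then m else None else None.

(** The decision depends only on the period, counted from 0 as [(size vs).-1], and on the current
    arrival, the last entry of [vs]; hence periods are independent. *)
Definition policy_decide (w : unit) (vs : seq (demand I))
    (ms : seq (option (supply I))) : option (supply I) :=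
  if rev vs is v :: _ then neighbor_only v (g (size vs).-1 v) else None.

Lemma policy_decide_measurable vs ms m :
  measurable [set w : unit | policy_decide w vs ms = m].
Proof. by []. Qed.

Lemma policy_decide_neighbor w vs v ms u :
  policy_decide w (rcons vs v) ms = Some u -> 0 < mu u v.
Proof.
rewrite /policy_decide rev_rcons size_rcons /= /neighbor_only.
by case: (g _ v) => // u'; case: ifP => // mu0 [<-].
Qed.

Definition policy_alg : delayed_alg I :=
  DelayedAlg (\d_tt : probability unit R)
    policy_decide_measurable policy_decide_neighbor.

Lemma policy_decision (vs : (horizon I).-tuple (demand I)) t :
  decision (tt : seed policy_alg) vs t =
  neighbor_only (tnth vs t) (g t (tnth vs t)).
Proof.
rewrite /decision nth_decisions //= /policy_decide.
have ts : (t < size vs)%N by rewrite size_tuple.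
rewrite (take_nth (tnth vs t) ts) rev_rcons size_rcons size_take ts /=.
by rewrite -tnth_nth.
Qed.

(** By independence, [u] escapes consumption with the product over periods of its escape
    probabilities, each averaged over the arriving type. *)
Lemma policy_value :
  seed_value (tt : seed policy_alg) =
  \sum_u (1 - \prod_(t < horizon I)
    (1 - \sum_v arrival v * mu u v * (g t v == Some u)%:R)).
Proof.
pose T := horizon I.
pose d t v := neighbor_only v (g t v).
have dE u t v : mu u v * (d t v == Some u)%:R = mu u v * (g t v == Some u)%:R.
  rewrite /d /neighbor_only; case: (g t v) => // u'; case: ifPn => // mu0.
  have [[uu]|_] := Some u' =P Some u; last by rewrite !mulr0.
  move: mu0; rewrite uu => mu0; case/andP: (mu_itv u v) => u0 _.
  have /eqP -> : mu u v == 0 by rewrite eq_le u0 leNgt mu0.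
  by rewrite !mul0r.
have outcome1 t v : \sum_(b : bool) outcome_prob (d t v) v b = 1.
  by rewrite big_bool /outcome_prob /= addrC subrK.
have outcomeP (t : nat) u v :
    \sum_(b : bool) outcome_prob (d t v) v b *
      (1 - ((d t v == Some u) && b)%:R) = 1 - mu u v * (g t v == Some u)%:R.
  rewrite big_bool /outcome_prob /= andbT andbF subr0 mulr1 -dE.
  case: (d t v) => [u'|]; last by rewrite mul0r mulr0; ring.
  by case: eqP => [[->]|_]; rewrite /= ?mulr1n ?mulr0n; ring.
have inner (vs : T.-tuple (demand I)) :
    \sum_(c : T.-tuple bool)
      (\prod_(t < T) outcome_prob (decision (tt : seed policy_alg) vs t)
         (tnth vs t) (tnth c t)) *
      (num_consumed (tt : seed policy_alg) vs c)%:R =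
    \sum_u (1 - \prod_(t < T) (1 - mu u (tnth vs t) *
                                 (g t (tnth vs t) == Some u)%:R)).
  (* [o] weighs an outcome and [h u] indicates that it spares [u]; both sums over outcome tuples
     then factor over periods. *)
  pose o (t : 'I_T) b := outcome_prob (d t (tnth vs t)) (tnth vs t) b.
  pose h u (t : 'I_T) b : R := 1 - ((d t (tnth vs t) == Some u) && b)%:R.
  transitivity (\sum_(c : T.-tuple bool) \sum_u
      (\prod_(t < T) o t (tnth c t) -
       \prod_(t < T) (o t (tnth c t) * h u t (tnth c t)))).
    apply: eq_bigr => c _; rewrite /num_consumed card_exists_sum mulr_sumr.
    apply: eq_bigr => u _; rewrite big_split mulrBr mulr1.
    by congr (_ - _ * _); apply: eq_bigr => t _; rewrite ?policy_decision.
  rewrite exchange_big; apply: eq_bigr => u _.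
  rewrite sumrB; congr (_ - _).
    by rewrite (sum_tuple_prod o) big1 // => t _; exact: outcome1.
  rewrite (sum_tuple_prod (fun t b => o t b * h u t b)).
  by apply: eq_bigr => t _; exact: outcomeP.
rewrite /seed_value; under eq_bigr do rewrite inner mulr_sumr.
rewrite exchange_big; apply: eq_bigr => u _.
under eq_bigr do rewrite mulrBr mulr1 -big_split.
rewrite sumrB; congr (_ - _).
  by rewrite (sum_tuple_prod (fun _ => @arrival R I)) big1 // => t _; exact: arrival_sum.
rewrite (sum_tuple_prod (fun (t : 'I_T) v =>
  arrival v * (1 - mu u v * (g t v == Some u)%:R))).
apply: eq_bigr => t _; under eq_bigr do rewrite mulrBr mulr1 mulrA.
by rewrite sumrB arrival_sum.
Qed.

Lemma expected_policy :
  expected_ALG policy_alg = (seed_value (tt : seed policy_alg))%:E.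
Proof.
rewrite /expected_ALG unlock /= integral_dirac //=.
by rewrite diracT mul1e.
Qed.

End Policy.

Lemma big_option (R : nmodType) (U : finType) (F : option U -> R) :
  \sum_m F m = F None + \sum_u F (Some u).
Proof.
rewrite (bigD1 None) //=; congr (_ + _).
rewrite (reindex_omap Some id) => [|[]//]; apply: eq_bigl => u /=.
by rewrite eqxx.
Qed.

(** * Rounding an LP solution to a deterministic policy *)

Section Rounding.
Variables (R : realType) (I : instance R).

(* If [T p_v = 0] then [r] is identically 0, which is consistent with [x]
   because feasibility forces [x u v = 0]. *)
Definition match_prob (x : supply I -> demand I -> R) (v : demand I)
    (m : option (supply I)) : R :=
  let r u := x u v / ((horizon I)%:R * arrival v) in
  if m is Some u then r u else 1 - \sum_u r u.

Lemma match_prob_sum x v : \sum_m match_prob x v m = 1.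
Proof. by rewrite big_option /= subrK. Qed.

Lemma match_prob_ge0 k x v m : feasible k x -> 0 <= match_prob x v m.
Proof.
move=> [_ xv x0]; have n0 : 0 <= (horizon I)%:R * arrival v.
  by rewrite mulr_ge0 ?arrival_ge0.
case: m => [u|] /=; first by rewrite divr_ge0.
rewrite -mulr_suml subr_ge0; move: n0; rewrite le_eqVlt => /predU1P[<-|n0].
  by rewrite invr0 mulr0.
by rewrite ler_pdivrMr // mul1r.
Qed.

Lemma match_probE k x u v : feasible k x ->
  (horizon I)%:R * arrival v * match_prob x v (Some u) = x u v.
Proof.
move=> fx; have [n0|n0] := eqVneq ((horizon I)%:R * @arrival _ I v) 0.
  rewrite n0 mul0r; apply/esym/le_anti.
  have [_ _ x0] := fx.
  by rewrite x0 andbT -n0 (feasible_bound u v fx).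
by rewrite /= mulrC divfK.
Qed.

Lemma exists_policy_ge (k : R) (x : supply I -> demand I -> R) :
  0 < k -> feasible k x ->
  exists g : nat -> demand I -> option (supply I),
    objective x * ((1 - expR (- k)) / k) <=
    seed_value (tt : seed (policy_alg g)).
Proof.
move=> k0 fx; pose T := horizon I; pose q := match_prob x.
(* One [f] fixes a decision for every type within a period, and has probability [w f] when types
   draw independently from [q]; [e u f] is the chance that the arrival consumes [u], and [s u] is
   its mean. *)
pose F := {ffun demand I -> option (supply I)}.
pose w (f : F) : R := \prod_v q v (f v).
pose e u (f : F) : R := \sum_v arrival v * mu u v * (f v == Some u)%:R.
pose s u : R := \sum_v arrival v * mu u v * q v (Some u).
have w1 : \sum_f w f = 1 by exact/sum_ffun_prod1/match_prob_sum.
have W1 : \sum_(G : {ffun 'I_T -> F}) \prod_t w (G t) = 1.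
  exact: (@sum_ffun_prod1 _ _ _ (fun=> w)).
have we u : \sum_f w f * (1 - e u f) = 1 - s u.
  under eq_bigr do rewrite mulrBr mulr1.
  rewrite sumrB w1; congr (_ - _).
  under eq_bigr do rewrite mulr_sumr.
  rewrite exchange_big; apply: eq_bigr => v _.
  under eq_bigr do rewrite mulrCA.
  by rewrite -mulr_sumr sum_ffun_prod_eq //; exact: match_prob_sum.
have Ts u : T%:R * s u = \sum_v mu u v * x u v.
  rewrite mulr_sumr; apply: eq_bigr => v _.
  by rewrite -(match_probE u v fx) /q /T; ring.
have s01 u : 0 <= s u <= 1.
  have mq v : 0 <= mu u v * q v (Some u) <= 1.
    have [/andP[m0 m1] q0] := (mu_itv u v, match_prob_ge0 v (Some u) fx).
    have q1 : q v (Some u) <= 1.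
      rewrite -[leRHS](match_prob_sum x v) [leRHS](bigD1 (Some u)) // lerDl.
      by apply: sumr_ge0 => m _; exact: match_prob_ge0 fx.
    by rewrite mulr_ge0 // mulr_ile1.
  apply/andP; split.
    by apply: sumr_ge0 => v _; rewrite -mulrA mulr_ge0 ?arrival_ge0 //; case/andP: (mq v).
  rewrite -(arrival_sum I); apply: ler_sum => v _.
  by rewrite -mulrA ler_piMr ?arrival_ge0 //; case/andP: (mq v).
(* [G] draws an independent map for each period; some draw does at least as well as the average. *)
have [G HG] : exists G : {ffun 'I_T -> F},
    objective x * ((1 - expR (- k)) / k) <= \sum_u (1 - \prod_t (1 - e u (G t))).
  apply: (@exists_ge_average _ {ffun 'I_T -> F} (fun G => \prod_t w (G t))
    (fun G => \sum_u (1 - \prod_t (1 - e u (G t))))) => //.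
    by move=> G; do 2![apply: prodr_ge0 => ? _]; exact: match_prob_ge0 fx.
  under eq_bigr do rewrite mulr_sumr.
  rewrite exchange_big /objective mulr_suml; apply: ler_sum => u _.
  under eq_bigr do rewrite mulrBr mulr1 -big_split.
  (* Independence across periods turns the average of the escape product into [(1 - s u) ^+ T]. *)
  rewrite sumrB W1 -(bigA_distr_bigA (fun _ f => w f * (1 - e u f))) /=.
  rewrite we prodr_const card_ord -Ts; apply: one_minus_pow_ge => //.
  by rewrite Ts; case: fx.
(* [None] is a filler beyond the horizon; [policy_value] evaluates [g] only at periods below it. *)
exists (fun t v => if insub t is Some i then G i v else None).
rewrite policy_value; apply: le_trans HG _.
rewrite le_eqVlt; apply/orP; left; apply/eqP; apply: eq_bigr => u _.
congr (_ - _); apply: eq_bigr => t _.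
by congr (_ - _); apply: eq_bigr => v _; rewrite valK.
Qed.

End Rounding.

(** * Competitive ratio on both families *)

Theorem theorem3 (R : realType) (kappa : R) (kappa_gt0 : 0 < kappa) :
  let c := Num.max ((1 - expR (- kappa)) / kappa) (1 - expR (- kappa)) in
  exists ALG : forall I : instance R, delayed_alg I,
    (c%:E <= competitive_ratio ALG
               (fun I : instance R => undersupplied I kappa))%E /\
    (c%:E <= competitive_ratio ALG
               (fun I : instance R => oversupplied I kappa))%E.
Proof.
move=> c.
pose r : R := (1 - expR (- kappa)) / kappa.
have r0 : 0 <= r.
  by rewrite divr_ge0 ?subr_ge0 ?expR_le1 ?oppr_le0 // ltW.
have rk : 1 - expR (- kappa) = r * kappa by rewrite divfK ?gt_eqF.
have cE : c = Num.max r (r * kappa) by rewrite -rk.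
have policy (I : instance R) : exists g,
    OFF_I I kappa * r <= seed_value (tt : seed (@policy_alg R I g)).
  have [x fx <-] := OFF_I_attained I (ltW kappa_gt0).
  exact: exists_policy_ge.
exists (fun I => policy_alg (projT1 (cid (policy I)))).
have main (I : instance R) : 0 < OFF_I I 1 -> c * OFF_I I 1 <= OFF_I I kappa * r ->
    (c%:E <= expected_ALG (policy_alg (projT1 (cid (policy I)))) *
             ((OFF_I I 1)^-1)%:E)%E.
  move=> O0 le_c; rewrite expected_policy -EFinM lee_fin ler_pdivlMr //.
  exact: le_trans le_c (projT2 (cid (policy I))).
(* Since [0^-1 = 0], a zero optimum would give ratio 0; extremality of [kappa] will exclude it. *)
have OFF_gt0 (I : instance R) : OFF_I I 1 <> 0 -> 0 < OFF_I I 1.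
  by move=> /eqP O1; rewrite lt_neqAle eq_sym O1 OFF_I_ge0.
split; apply: le_ereal_inf_tmp => _ [I [[[K1 K2] K3 _] ->]]; apply: main.
(* With optimum 0 the larger [kappa + 1] would also qualify, against maximality. *)
- apply: OFF_gt0 => O1.
  suff /K3 : [set k | 1 <= k /\ OFF_I I k = k * OFF_I I 1] (kappa + 1).
    by rewrite gerDl ler10.
  split; first by rewrite (le_trans K1) // lerDl.
  by rewrite O1 mulr0 OFF_I_eq0 // addr_gt0.
(* Here [1 <= kappa], so the maximum [c] is [r * kappa]. *)
- rewrite K2 mulrAC ler_wpM2r ?OFF_I_ge0 //.
  by rewrite cE ge_max [kappa * r]mulrC lexx andbT ler_peMr.
(* With optimum 0 the smaller [kappa / 2] would also qualify, against minimality. *)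
- apply: OFF_gt0 => O1; have /andP[_ kappa_le1] := K1.
  have lt_half : kappa / 2 < kappa by rewrite ltr_pdivrMr // ltr_pMr // ltr1n.
  suff /K3 : [set k | 0 < k <= 1 /\ OFF_I I k = OFF_I I 1] (kappa / 2).
    by rewrite leNgt lt_half.
  split; last by rewrite O1 OFF_I_eq0 // divr_gt0.
  by rewrite divr_gt0 //= ltW // (lt_le_trans lt_half).
(* Here [kappa <= 1], so the maximum [c] is [r]. *)
- have /andP[_ kappa_le1] := K1; rewrite K2 [leRHS]mulrC ler_wpM2r ?OFF_I_ge0 //.
  by rewrite cE ge_max lexx ler_piMr.
Qed.
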